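(* Let $0<d_1<\cdots<d_k<n$ be integers. There is a (well-defined) map from the disjoint union of the $T$-orbit spaces to homology, given by $$\bigsqcup_{\mathbf{M}\in\mathcal{M}^{d_1,\dots,d_k}_n}\mathcal{F}_{\mathbf{M}}\longrightarrow H_*(\mathbb{F}_{d_1<\cdots<d_k}(\mathbb{C}^n),\mathbb{Z}),\qquad y\longmapsto\left[\overline{\mathbb{V}_{\mathbf{M}}(y)}\right]\quad(y\in\mathcal{F}_{\mathbf{M}}).$$
   Context: For a closed irreducible subvariety $Y$ of the flag variety, $[Y]$ denotes its (fundamental) homology class in $H_*(\mathbb{F}_{d_1<\cdots<d_k}(\mathbb{C}^n),\mathbb{Z})$; $\overline{\mathbb{V}_{\mathbf{M}}(y)}$ is the closure in the flag variety of the scheme-theoretic point $\mathbb{V}_{\mathbf{M}}(y)$. $[n]=\{1,\dots,n\}$ and $\binom{[n]}{d}$ is the set of $d$-element subsets of $[n]$. A matroid of rank $d$ on $n$ elements is a pair $M=([n],\mathcal{B})$ with $\emptyset\neq\mathcal{B}\subset\binom{[n]}{d}$ such that for all $I,J\in\mathcal{B}$ and $i\in I\setminus J$ there is $j\in J\setminus I$ with $(I\setminus\{i\})\cup\{j\}\in\mathcal{B}$. $\mathcal{M}^d_n$ is the set of such matroids, and $\mathcal{M}^{d_1,\dots,d_k}_n=\mathcal{M}^{d_1}_n\times\cdots\times\mathcal{M}^{d_k}_n$; its elements are called plurimatroids. $G(d,n)$ is the Grassmannian of $d$-dimensional subspaces of $\mathbb{C}^n$ (row vectors), with Plücker coordinates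 $(p_I)_{I\in\binom{[n]}{d}}$. For $M=([n],\mathcal{B})\in\mathcal{M}^d_n$, $G_M=\{W\in G(d,n): p_I(W)\neq0\Leftrightarrow I\in\mathcal{B}\}$. The flag variety is $\mathbb{F}_{d_1<\cdots<d_k}(\mathbb{C}^n)=\{W_1\subset\cdots\subset W_k\subset\mathbb{C}^n:\dim W_i=d_i\}\subset\prod_{i}G(d_i,n)$. The thin Schubert cell of $\mathbf{M}=(M_1,\dots,M_k)$ is $\mathbb{F}_{\mathbf{M}}=\left(\prod_{i=1}^kG_{M_i}\right)\cap\mathbb{F}_{d_1<\cdots<d_k}(\mathbb{C}^n)$, an affine locally closed subvariety. $T<\mathrm{GL}_n(\mathbb{C})$ is the torus of invertible diagonal matrices, acting on the right by $(W_1,\dots,W_k)\cdot g=(W_1g,\dots,W_kg)$; each $\mathbb{F}_{\mathbf{M}}$ is $T$-invariant, and all points of a nonempty $\mathbb{F}_{\mathbf{M}}$ have the same isotropy group $\mathrm{Stab}_T(\mathbb{F}_{\mathbf{M}})$. Put $T_{\mathbf{M}}=T/\mathrm{Stab}_T(\mathbb{F}_{\mathbf{M}})$. $\mathcal{F}_{\mathbf{M}}$ denotes the universal geometric quotient (in the sense of Mumford's GIT; it exists) of $\mathbb{F}_{\mathbf{M}}$ by $T_{\mathbf{M}}$, with quotient morphism $\pi:\mathbb{F}_{\mathbf{M}}\to\mathcal{F}_{\mathbf{M}}$; $\mathcal{F}_{\mathbf{M}}=\emptyset$ if $\mathbb{F}_{\mathbf{M}}=\emptyset$. All varieties are viewed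 as schemes, and points are scheme-theoretic points. $\mathbb{F}_{d_1<\cdots<d_k}(\mathbb{C}^n)^T$ is the set of scheme-theoretic points $\eta$ of the flag variety such that $\overline{\{\eta\}}$ is $T$-invariant. The map $\mathbb{V}_{\mathbf{M}}:\mathcal{F}_{\mathbf{M}}\to\mathbb{F}_{d_1<\cdots<d_k}(\mathbb{C}^n)^T$ sends $y$ to the point $\eta$ with $\overline{\{\eta\}}=\overline{\pi^{-1}(Y)}$, where $Y=\overline{\{y\}}\subset\mathcal{F}_{\mathbf{M}}$ and the closures of $\{\eta\}$ and $\pi^{-1}(Y)$ are taken in the flag variety. *)

(* Defs.v *)
From HB Require Import structures.
From mathcomp Require Import all_boot all_order all_algebra finmap.
From mathcomp Require Import complex.
From mathcomp Require Import -(notations) freeg.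
From mathcomp Require Import -(notations) mpoly.
From mathcomp Require Import all_classical all_reals all_analysis.

Set Implicit Arguments.
Unset Strict Implicit.
Unset Printing Implicit Defensive.

Import Order.TTheory GRing.Theory Num.Theory numFieldNormedType.Exports.

Local Open Scope classical_set_scope.
Local Open Scope ring_scope.

Definition irreducible_set {X : topologicalType} (A : set X) : Prop :=
  A !=set0 /\
  forall B D : set X, closed B -> closed D ->
    A `<=` B `|` D -> A `<=` B \/ A `<=` D.

(* A complex variety is given by its space X of closed points with the
   Zariski topology.  The points of the associated scheme are the irreducible
   closed subsets of X: eta is represented by the set of closed points of the
   closure of {eta}.  Thus [spoint X] is also the type of closed irreducible
   subvarieties of X. *)
Definition is_spoint (X : topologicalType) (A : set X) : bool :=
  `[< closed A /\ irreducible_set A >].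

Definition spoint (X : topologicalType) : Type := {A : set X | is_spoint A}.

HB.instance Definition _ (X : topologicalType) := Choice.on (spoint X).

(* The topology of the scheme: its open subsets are the
   {eta | eta meets U}, for U open in X. *)
HB.instance Definition _ (X : topologicalType) :=
  isSubBaseTopological.Build (spoint X)
    [set [set p : spoint X | sval p `&` U !=set0] | U in @open X] id.

Lemma closure_spoint1 (X : topologicalType) (eta : spoint X) :
  closure [set eta] = [set xi : spoint X | sval xi `<=` sval eta].
Proof.
have ov (U : set X) : open U -> open [set p : spoint X | sval p `&` U !=set0].
  move=> oU.
  pose S := [set p : spoint X | sval p `&` U !=set0].
  exists [set S]; last by rewrite bigcup_set1.
  move=> _ ->; exists [fset S]%fset => //.
    by move=> A; move=> /fset1P ->; rewrite inE; exists U.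
  rewrite predeqE => p.
  by split => [/(_ S)|Sp A /=]; [apply; exact/fset1P | move=> /fset1P ->].
rewrite predeqE => xi; split => [cl x xix|sub N].
  apply: contrapT => nx.
  have /asboolP [ceta _] := svalP eta.
  have [|q [-> [z [ez nez]]]] :=
      cl [set p : spoint X | sval p `&` ~` sval eta !=set0].
    apply: open_nbhs_nbhs; split; last by exists x.
    by apply: ov; rewrite openC.
  exact: nez.
rewrite nbhsE => -[B [oB Bxi] BN]; exists eta; split => //; apply: BN.
case: oB Bxi => D' sD' <- [A DA Axi]; exists A => //.
have [F sF FA] := sD' _ DA.
move: Axi; rewrite -FA => FAxi.
change (forall S, S \in F -> S eta) => S SF.
have := sF _ SF; rewrite inE => -[U oU US].
have : S xi := FAxi _ SF.
rewrite -US /= => -[x [xix Ux]].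
by exists x; split => //; apply: sub.
Qed.

Section SpointMap.
Variables (X Y : topologicalType) (f : X -> Y) (cf : continuous f).

Fact spmap_subproof (p : spoint X) : is_spoint (closure (f @` sval p)).
Proof.
case: p => A /= /asboolP [_ [[x Ax] irrA]]; apply/asboolP.
split; first exact: closed_closure.
split; first by exists (f x); apply: subset_closure; exists x.
move=> B D cB cD sub.
have clf (E : set Y) : closed E -> closed (f @^-1` E).
  by move=> cE; apply: preimage_closed => // ? _; exact: cf.
have [s|s] := irrA _ _ (clf _ cB) (clf _ cD)
  (fun a Aa => sub _ (subset_closure (imageP f Aa))).
- left; rewrite (closure_id B).1 //; apply: closureS.
  by move=> _ [a Aa <-]; exact: s.
- right; rewrite (closure_id D).1 //; apply: closureS.
  by move=> _ [a Aa <-]; exact: s.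
Qed.

(* the action on points of the morphism of schemes induced by f *)
Definition spmap (p : spoint X) : spoint Y :=
  exist (fun A => is_spoint A) _ (spmap_subproof p).

End SpointMap.

Definition is_matroid (n d : nat) (B : {set {set 'I_n}}) : bool :=
  [&& B != finset.set0,
      [forall I in B, #|I| == d] &
      [forall I in B, forall J in B, forall i in I :\: J,
         exists j in J :\: I, (j |: (I :\ i))%SET \in B]].

Definition matroid (n d : nat) : Type :=
  {B : {set {set 'I_n}} | is_matroid d B}.

Definition plurimatroid (n k : nat) (d : 'I_k -> nat) : Type :=
  forall i : 'I_k, matroid n (d i).

Section Flag.
Variables (R : realType) (n k : nat) (d : 'I_k -> nat).
Local Notation C := R[i].

Definition is_flag (W : {ffun 'I_k -> {vspace 'rV[C]_n}}) : bool :=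
  [forall i, \dim (W i) == d i] &&
  [forall i : 'I_k, forall j : 'I_k, (i <= j)%N ==> (W i <= W j)%VS].

Definition flag : Type := {W : {ffun 'I_k -> {vspace 'rV[C]_n}} | is_flag W}.

HB.instance Definition _ := Choice.on flag.

(* The Plücker coordinates computed from the basis [vbasis U]; they are
   determined by U up to a common nonzero factor.  The coordinates p_I with
   #|I| <> \dim U, which do not exist, are set to 0. *)
Definition plucker (U : {vspace 'rV[C]_n}) (I : {set 'I_n}) : C :=
  if #|I| == \dim U then
    \det (\matrix_(a < #|I|, b < #|I|) (vbasis U)`_a 0 (enum_val b))
  else 0.

(* (i, I) stands for the coordinate p_I of the i-th subspace *)
Definition pvar : finType := ('I_k * {set 'I_n})%type.

Definition peval (f : mpoly #|pvar| C) (W : flag) : C :=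
  meval (fun v : 'I_#|pvar| =>
    plucker (sval W (enum_val v).1) (enum_val v).2) f.

Definition multihomog (e : 'I_k -> nat) (f : mpoly #|pvar| C) : Prop :=
  forall m, m \in msupp f ->
    forall i, (\sum_(v < #|pvar| | (enum_val v).1 == i) m v)%N = e i.

(* the Zariski topology induced by the Plücker embedding in a product of
   projective spaces *)
HB.instance Definition _ :=
  isSubBaseTopological.Build flag
    [set [set W : flag | peval f W != 0]
       | f in [set f | exists e, multihomog e f]]
    id.

(* Regular functions on an open subset U of a locally closed subvariety X of
   the flag variety, j being the inclusion of X.  The values of f outside U
   are irrelevant. *)
Definition regular (X : topologicalType) (j : X -> flag) (U : set X)
    (f : X -> C) : Prop :=
  forall x, U x -> exists e g h,
    [/\ multihomog e g, multihomog e h, peval h (j x) != 0 &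
        \forall x' \near x, f x' = peval g (j x') / peval h (j x')].

Definition torus : Type :=
  {g : 'M[C]_n | is_diag_mx g && (g \in unitmx)}.

Definition translate (g : torus) (U : {vspace 'rV[C]_n}) : {vspace 'rV[C]_n} :=
  (linfun (mulmxr (sval g)) @: U)%VS.

Fact act_subproof (W : flag) (g : torus) :
  is_flag [ffun i => translate g (sval W i)].
Proof.
have /andP [/forallP dW /forallP mW] := svalP W.
have /andP [_ ug] := svalP g.
have lk : lker (linfun (mulmxr (sval g)) : 'End('rV[C]_n)) = 0%VS.
  apply/eqP/lker0P => u v; rewrite !lfunE /=.
  by move=> /(congr1 (mulmx^~ (invmx (sval g)))); rewrite !mulmxK.
apply/andP; split.
  by apply/forallP => i; rewrite ffunE limg_dim_eq ?lk ?capv0.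
apply/forallP => i; apply/forallP => j; apply/implyP => ij; rewrite !ffunE.
by apply: limgS; have /forallP/(_ j)/implyP := mW i; apply.
Qed.

Definition act (W : flag) (g : torus) : flag :=
  exist (fun W => is_flag W) _ (act_subproof W g).

Definition thin_cell (M : plurimatroid n d) : set flag :=
  [set W : flag | forall i (I : {set 'I_n}), #|I| = d i ->
             (plucker (sval W i) I != 0) = (I \in sval (M i))].

(* Geometric quotients of F_M by the torus (Mumford, GIT, Definition 0.6), in
   terms of closed points: [gq_space] is the Zariski space of closed points
   and [gq_reg U] the ring of regular functions on U.  T and T_M have the same
   orbits in F_M, hence the same geometric quotients.  The fields determine
   the quotient up to isomorphism, so that every universal geometric quotient
   is of this form. *)
Record geometric_quotient (M : plurimatroid n d) := GeometricQuotient {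
  gq_space :> topologicalType;
  gq_reg : set gq_space -> set (gq_space -> C);
  gq_pi : thin_cell M -> gq_space;
  gq_surj : forall q, exists x, gq_pi x = q;
  gq_fiber : forall x x', gq_pi x = gq_pi x' <->
    exists g, set_val x' = act (set_val x) g;
  gq_open : forall U, open U <-> open (gq_pi @^-1` U);
  gq_regP : forall U f, open U ->
    (gq_reg U f <-> regular set_val (gq_pi @^-1` U) (f \o gq_pi))
}.

Fact gq_pi_continuous M (Q : geometric_quotient M) : continuous (@gq_pi M Q).
Proof. by apply/continuousP => U /gq_open. Qed.

Fact incl_continuous M : continuous (set_val : thin_cell M -> flag).
Proof. exact: initial_continuous. Qed.

Definition flagT : set (spoint flag) :=
  [set eta : spoint flag | forall W g, sval eta W -> sval eta (act W g)].

(* the graph of V_M *)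
Definition isV M (Q : geometric_quotient M) (y : spoint Q) (eta : spoint flag)
    : Prop :=
  flagT eta /\
  closure [set eta] =
  closure (spmap (@incl_continuous M) @`
             (spmap (@gq_pi_continuous M Q) @^-1` closure [set y])).

End Flag.

Arguments gq_pi {R n k d M} _ _.

Local Notation "{ 'freeab' K }" := (FreegDefs.type_of (Phant int) (Phant K))
  (at level 0, K at level 2).

Definition simplex (R : realType) (q : nat) : set 'rV[R]_q.+1 :=
  [set t | (forall i, 0 <= t 0 i) /\ \sum_i t 0 i = 1].
Arguments simplex : clear implicits.

Section Homology.
Variable R : realType.
Local Notation simplex := (simplex R).

Fact face_subproof q (i : 'I_q.+2) (t : simplex q) :
  (\row_j if unlift i j is Some j' then set_val t 0 j' else 0) \in simplex q.+1.
Proof.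
have [t0 t1] := set_valP t; apply/mem_set; split.
  by move=> j; rewrite mxE; case: (unlift i j).
rewrite (bigD1_ord i) //= mxE unlift_none add0r -[RHS]t1.
by apply: eq_bigr => j _; rewrite mxE liftK.
Qed.

Definition face q (i : 'I_q.+2) (t : simplex q) : simplex q.+1 :=
  exist (fun u => u \in simplex q.+1) _ (face_subproof i t).

Variable X : topologicalType.

(* All maps from a simplex to X; continuity is imposed in [chains_in]. *)
Definition ssimplex : Type := {q : nat & simplex q -> X}.
HB.instance Definition _ := gen_eqMixin ssimplex.
HB.instance Definition _ := gen_choiceMixin ssimplex.

(* chains of all degrees at once, so that the homology below is the direct
   sum of the homology groups of all degrees *)
Definition chain : Type := {freeab ssimplex}.
HB.instance Definition _ := GRing.Lmodule.on chain.

Definition ch (s : ssimplex) : chain := Freeg [:: (1, s)].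

Definition bdry1 (s : ssimplex) : chain :=
  match s with
  | existT 0 _ => 0
  | existT q.+1 sigma =>
      \sum_(i < q.+2) (-1) ^+ i *: ch (existT _ q (sigma \o face i))
  end.

Definition bdry : chain -> chain := fglift bdry1.

Definition in_simplex (A : set X) (s : ssimplex) : bool :=
  let: existT q sigma := s in
  `[< continuous (sigma : simplex q -> X) /\ forall t, A (sigma t) >].

(* the singular chains of A, as chains of X *)
Definition chains_in (A : set X) (c : chain) : bool :=
  all (in_simplex A) (dom c).

Definition is_cycle (c : chain) : bool := chains_in setT c && (bdry c == 0).

Fact chains_in_zmod (A : set X) : zmod_closed (chains_in A).
Proof.
split; first by rewrite unfold_in /chains_in dom0.
move=> b c /allP bA /allP cA; apply/allP => s /domB.
by rewrite mem_cat => /orP[/bA|/cA].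
Qed.

Fact bdry_zmod_morphism : zmod_morphism bdry.
Proof. exact: lift_is_additive. Qed.
HB.instance Definition _ :=
  GRing.isZmodMorphism.Build chain chain bdry bdry_zmod_morphism.

Fact is_cycle_zmod : zmod_closed is_cycle.
Proof.
have [X0 XB] := chains_in_zmod setT; split.
  by rewrite unfold_in /is_cycle raddf0 eqxx andbT; exact: X0.
move=> b c /andP[bX /eqP b0] /andP[cX /eqP c0].
rewrite unfold_in /is_cycle bdry_zmod_morphism b0 c0 subrr eqxx andbT.
exact: (XB _ _ bX cX).
Qed.
HB.instance Definition _ :=
  GRing.isZmodClosed.Build chain is_cycle is_cycle_zmod.

Definition cycle : Type := {c : chain | is_cycle c}.
HB.instance Definition _ := SubChoice.on cycle.
HB.instance Definition _ := [SubChoice_isSubZmodule of cycle by <:].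

Definition is_boundary (z : cycle) : bool :=
  `[< exists2 b, chains_in setT b & val z = bdry b >].

Fact is_boundary_zmod : zmod_closed is_boundary.
Proof.
have [X0 XB] := chains_in_zmod setT; split.
  by apply/asboolP; exists 0; [exact: X0 | rewrite !raddf0].
move=> y z /asboolP[b bX yE] /asboolP[c cX zE]; apply/asboolP.
exists (b - c); first exact: (XB _ _ bX cX).
by rewrite bdry_zmod_morphism -yE -zE raddfB.
Qed.
HB.instance Definition _ :=
  GRing.isZmodClosed.Build cycle is_boundary is_boundary_zmod.

Definition homology : Type :=
  Quotient.quot (GRing.ZmodClosed.clone cycle is_boundary _).
HB.instance Definition _ := GRing.Zmodule.on homology.

Definition hclass (z : cycle) : homology :=
  (\pi_(Quotient.quot (GRing.ZmodClosed.clone cycle is_boundary _)) z)%qT.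

End Homology.

Section FundamentalClass.
Variables (R : realType) (n k : nat) (d : 'I_k -> nat).
Local Notation C := R[i].
Local Notation flag := (flag R n d).

(* The flag variety with its Euclidean topology: the coarsest topology for
   which the Zariski-open subsets are open and the regular functions on them
   are continuous *)
Definition aflag : Type := flag.
HB.instance Definition _ := Choice.on aflag.
HB.instance Definition _ :=
  isSubBaseTopological.Build aflag
    [set S | exists (U : set flag) (f : flag -> C) (V : set C^o),
       [/\ open U, regular id U f, open V & S = [set W | U W /\ V (f W)]]] id.

(* [is_chart Y D phi]: phi parametrizes a relatively open subset of Y by the
   open subset D of C^m, biholomorphically; its inverse is given by functions
   that are regular on a Zariski-open neighborhood of the image.  The points
   of Y in the image of such a phi are the regular points of Y at which Y has
   dimension m. *)
Definition is_chart (Y : set flag) (m : nat) (D : set 'rV[C^o]_m)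
    (phi : 'rV[C^o]_m -> aflag) : Prop :=
  [/\ open D,
      {within D, continuous phi},
      exists2 N : set aflag, open N & phi @` D = N `&` Y,
      exists (U : set flag) (u : 'I_m -> flag -> C),
        [/\ open U, forall l, regular id U (u l) &
            forall z, D z -> U (phi z) /\ forall l, u l (phi z) = z 0 l] &
      forall (U : set flag) (f : flag -> C), open U -> regular id U f ->
        forall z, D z -> U (phi z) -> differentiable (f \o phi : _ -> C^o) z].

(* The affine simplex in C^m with barycenter z and vertices z + r w_i, where
   w_1, ..., w_2m is the real basis e_1, 'i e_1, e_2, 'i e_2, ... and
   w_0 = - (w_1 + ... + w_2m).  It is positively oriented for the complex
   orientation. *)
Definition affine_simplex (m : nat) (z : 'rV[C^o]_m) (r : R)
    (t : simplex R m.*2) : 'rV[C^o]_m :=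
  let x (j : nat) : R := set_val t 0 (inord j) in
  \row_l (z 0 l + ((r * (x l.*2.+1 - x 0)) +i* (r * (x l.*2.+2 - x 0)))%C).

(* The cycle c represents the fundamental class of the closed irreducible
   subvariety Y of dimension m: it is a 2m-cycle in Y which induces the
   complex orientation class in H_2m(Y, Y \ p) at every regular point p.  *)
Definition is_fundamental_cycle (Y : set flag) (c : chain R aflag) : Prop :=
  exists m : nat,
  [/\ exists D (phi : 'rV[C^o]_m -> aflag), is_chart Y D phi /\ D !=set0,
      chains_in Y c, {in dom c, forall s, projT1 s = m.*2},
      bdry c = 0 &
      forall D (phi : 'rV[C^o]_m -> aflag) z (r : R),
        is_chart Y D phi -> 0 < r -> (forall t, D (affine_simplex z r t)) ->
        exists b e, [/\ chains_in Y b, chains_in (Y `\ phi z) e &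
          c = ch (existT _ m.*2 (phi \o affine_simplex z r)) + bdry b + e]].

Definition Hflag : Type := homology R aflag.
HB.instance Definition _ := GRing.Zmodule.on Hflag.

(* The class of a fundamental cycle of Y exists and is unique, as H_2m(Y, Z) is
   infinite cyclic and maps isomorphically to H_2m(Y, Y \ p) at regular
   points p. *)
Definition fundamental_class (Y : spoint flag) : Hflag :=
  xget 0 [set h | exists2 c : cycle R aflag,
    is_fundamental_cycle (sval Y) (val c) & h = hclass c].

End FundamentalClass.

(* Main.v *)
Require Import Defs.
From HB Require Import structures.
From mathcomp Require Import all_boot all_order all_algebra finmap.
From mathcomp Require Import complex.
From mathcomp Require Import -(notations) mpoly.
From mathcomp Require Import all_classical all_reals all_analysis.

(* Write Z for the preimage of Y in the thin Schubert cell.  A T-orbit is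
   irreducible, being parametrized by an open subset of the affine space of
   diagonal matrices, and the quotient map pi is open because T acts by
   homeomorphisms.  If two open sets meet Z, their images under pi therefore
   meet in a point of the irreducible Y, and both sets meet the orbit over that
   point; so they meet each other in Z.  Hence Z is irreducible, and its closure
   in the flag variety is the point V_M(y). *)

Set Implicit Arguments.
Unset Strict Implicit.
Unset Printing Implicit Defensive.

Import Order.TTheory GRing.Theory Num.Theory.

Local Open Scope classical_set_scope.
Local Open Scope ring_scope.

(** * Irreducible sets and generic points *)

Section SchemePoints.
Variable X : topologicalType.
Implicit Types (A : set X) (p q : spoint X).

Lemma closed_spoint p : closed (sval p).
Proof. by have /asboolP[] := svalP p. Qed.

Lemma irreducible_spoint p : irreducible_set (sval p).
Proof. by have /asboolP[] := svalP p. Qed.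

(** Complements turn the definition by closed sets into the form with open sets, which passes
    through the open map [gq_pi]. *)
Lemma irreducible_setP A :
  irreducible_set A <-> A !=set0 /\ forall U V, open U -> open V ->
    A `&` U !=set0 -> A `&` V !=set0 -> A `&` (U `&` V) !=set0.
Proof.
split=> -[A0 irrA]; split => //.
  move=> U V oU oV [x [Ax Ux]] [y [Ay Vy]].
  apply: contrapT => N.
  have [z Az|/(_ _ Ax)//|/(_ _ Ay)//] :=
    irrA _ _ (open_closedC oU) (open_closedC oV).
  apply: contrapT => /not_orP[/contrapT Uz /contrapT Vz].
  by apply: N; exists z.
move=> B D cB cD sub.
apply: contrapT => /not_orP[/existsNP[x /not_implyP[Ax Bx]]].
move=> /existsNP[y /not_implyP[Ay Dy]].
have [||z [Az [Bz Dz]]] := irrA _ _ (closed_openC cB) (closed_openC cD).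
- by exists x.
- by exists y.
by case: (sub z Az).
Qed.

(** A closed irreducible set has only one generic point; this is what makes V_M(y) unique. *)
Lemma closure_spoint1_inj p q : closure [set p] = closure [set q] -> p = q.
Proof.
rewrite !closure_spoint1 => pq; apply: val_inj => /=; apply/seteqP; split.
  by change ([set xi : spoint X | sval xi `<=` sval q] p); rewrite -pq.
by change ([set xi : spoint X | sval xi `<=` sval p] q); rewrite pq.
Qed.

End SchemePoints.

(** * Basis matrices of subspaces *)

Lemma reindex_cast_ord S (idx : S) {op : Monoid.com_law idx} m p
    (E : m = p) (F : 'I_p -> S) :
  \big[op/idx]_(i < p) F i = \big[op/idx]_(i < m) F (cast_ord E i).
Proof. by case: p / E F => F; apply: eq_bigr => i _; rewrite cast_ord_id. Qed.

Section VspaceMinors.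
Variables (F : fieldType) (n m : nat).
Implicit Types U V : {vspace 'rV[F]_n}.

(** The number m of rows is kept apart from [\dim U], so that the matrices of a subspace and of its
    image have the same type. *)
Definition vbasis_mx U : 'M[F]_(m, n) := \matrix_(a, j) (vbasis U)`_a 0 j.

Lemma mul_vbasis_mx U (u : 'rV_m) :
  u *m vbasis_mx U = \sum_i u 0 i *: (vbasis U)`_i.
Proof.
apply/rowP => j; rewrite mxE summxE; apply: eq_bigr => i _.
by rewrite !mxE.
Qed.

Lemma row_free_vbasis_mx U : \dim U = m -> row_free (vbasis_mx U).
Proof.
move=> dU; apply: inj_row_free => v; rewrite mul_vbasis_mx => v0.
have := basis_free (vbasisP U); move: v v0.
move: (vbasis U); rewrite dU => X v v0 /freeP fX.
by apply/rowP => i; rewrite mxE; exact: fX v0 i.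
Qed.

(** P writes the chosen basis of V in the images of the chosen basis of U. Its rank is at least that
    of the basis matrix of V, which is m. *)
Lemma vbasis_mx_limg U V (g : 'M[F]_n) :
  \dim U = m -> \dim V = m -> V = (linfun (mulmxr g) @: U)%VS ->
  exists2 P : 'M[F]_m, P \in unitmx & vbasis_mx V = P *m vbasis_mx U *m g.
Proof.
move=> dU dV VE.
have memV a : (a < m)%N ->
    exists u : 'rV_m, (vbasis V)`_a = u *m vbasis_mx U *m g.
  move=> am.
  have : (vbasis V)`_a \in V.
    by apply/vbasis_mem/mem_nth; rewrite size_tuple dV.
  move: (vbasis V)`_a => v; rewrite VE => /memv_imgP[u uU ->]; rewrite lfunE /=.
  move: (coord_vbasis uU) (mul_vbasis_mx U); move: (vbasis U) => X uE muE.
  exists (\row_(b < m) coord X (cast_ord (esym dU) b) u).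
  rewrite muE {1}uE; congr (_ *m _).
  rewrite (reindex_cast_ord (esym dU)) /=.
  by apply: eq_bigr => b _; rewrite mxE.
have /(_ _)/cid-/all_sig[u uE] a := memV (nat_of_ord a) (ltn_ord (a : 'I_m)).
have PE : vbasis_mx V = (\matrix_a u a) *m vbasis_mx U *m g.
  apply/row_matrixP => a; rewrite -mulmxA row_mul rowK mulmxA -uE.
  by apply/rowP => j; rewrite !mxE.
exists (\matrix_a u a) => //; rewrite -row_free_unit.
have /eqP r := row_free_vbasis_mx dV.
rewrite /row_free eqn_leq rank_leq_row /= -{1}r PE -mulmxA.
exact: mxrankM_maxl.
Qed.

End VspaceMinors.

(** * The torus action in Plücker coordinates *)

Section Flags.
Variables (R : realType) (n k : nat) (d : 'I_k -> nat).
Local Notation C := R[i].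
Local Notation flag := (flag R n d).
Implicit Types (W : flag) (g h : torus R n) (f : mpoly #|pvar n k| C).

Lemma torus_diag g : sval g = diag_mx (\row_i sval g i i).
Proof.
have /andP[/is_diag_mxP dg _] := svalP g.
apply/matrixP => i j; rewrite !mxE; case: eqVneq => [->|ij].
  by rewrite mulr1n.
by rewrite mulr0n dg // -val_eqE.
Qed.

Lemma torus_neq0 g i : sval g i i != 0.
Proof.
have /andP[_] := svalP g; rewrite unitmxE {1}torus_diag det_diag unitfE.
by move=> /prodf_neq0/(_ i isT); rewrite mxE.
Qed.

Lemma diag_torus (v : 'I_n -> C) : (forall i, v i != 0) ->
  exists g, forall i, sval g i i = v i.
Proof.
move=> v0; pose D := diag_mx (\row_i v i).
have DP : is_diag_mx D && (D \in unitmx).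
  rewrite diag_mx_is_diag unitmxE det_diag unitfE prodf_seq_neq0.
  by apply/allP => i _; rewrite mxE v0.
exists (exist (fun A => is_diag_mx A && (A \in unitmx)) _ DP) => i.
by rewrite !mxE eqxx mulr1n.
Qed.

Lemma dim_translate g U : \dim (translate g U) = \dim U.
Proof.
have /andP [_ ug] := svalP g.
rewrite limg_dim_eq //; apply/eqP; rewrite -subv0; apply/subvP => u.
rewrite memv_cap => /andP[_]; rewrite memv_ker lfunE /= memv0 => /eqP ug0.
by rewrite -(mulmxK ug u) ug0 mul0mx.
Qed.

(** With m free, the minors of U and of its translate can both be taken with m equal to [\dim U]. *)
Lemma plucker_colsub (U : {vspace 'rV[C]_n}) m (I : {set 'I_n})
    (dU : #|I| = \dim U) (Im : m = #|I|) :
  plucker U I =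
  \det (colsub (fun b : 'I_m => enum_val (cast_ord Im b)) (vbasis_mx m U)).
Proof.
subst m; rewrite /plucker ifT; last exact/eqP.
congr (\det _).
by apply/matrixP => a b; rewrite !mxE cast_ord_id.
Qed.

(** Two effects are separated: c is the determinant of a change of basis, common to all I, while g
    scales the columns selected by I. *)
Lemma plucker_translate g U :
  exists2 c : C, c != 0 & forall I,
    plucker (translate g U) I = c * ((\prod_(i in I) sval g i i) * plucker U I).
Proof.
have [P uP PE] := vbasis_mx_limg erefl (dim_translate g U) erefl.
exists (\det P); first by rewrite -unitfE -unitmxE.
move=> I; have [E|NE] := eqVneq #|I| (\dim U); last first.
  by rewrite /plucker !ifN ?dim_translate // !mulr0.
rewrite (plucker_colsub _ (esym E)) ?dim_translate //.
rewrite (plucker_colsub E (esym E)) PE.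
rewrite big_enum_val.
(* As a diagonal determinant, the weight of I merges with the other two factors by
   multiplicativity. *)
have -> : \prod_(i < #|I|) sval g (enum_val i) (enum_val i) =
  \det (diag_mx (\row_(b < \dim U)
    sval g (enum_val (cast_ord (esym E) b)) (enum_val (cast_ord (esym E) b)))).
  rewrite det_diag (reindex_cast_ord (esym E)) /=.
  by apply: eq_bigr => b _; rewrite mxE.
rewrite {1}torus_diag [X in _ = _ * X]mulrC -!det_mulmx mulmxA.
rewrite mulmx_colsub mul_mx_diag; congr (\det _).
by apply/matrixP => a b; rewrite mul_mx_diag !mxE.
Qed.

Lemma plucker_act W g i : exists2 c : C, c != 0 & forall I,
  plucker (sval (act W g) i) I =
  c * ((\prod_(j in I) sval g j j) * plucker (sval W i) I).
Proof. by rewrite ffunE; exact: plucker_translate. Qed.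

Lemma plucker_act_neq0 W g i I :
  (plucker (sval (act W g) i) I != 0) = (plucker (sval W i) I != 0).
Proof.
have [c c0 ->] := plucker_act W g i.
have w0 : \prod_(j in I) sval g j j != 0.
  by apply/prodf_neq0 => j _; exact: torus_neq0.
by rewrite !mulf_eq0 (negbTE c0) (negbTE w0).
Qed.

(** * Multihomogeneous polynomials *)

Lemma multihomog_meval e f (c : 'I_k -> C) (y : 'I_#|pvar n k| -> C) :
  multihomog e f ->
  meval (fun v => c (enum_val v).1 * y v) f = (\prod_i c i ^+ e i) * meval y f.
Proof.
move=> ef; rewrite !mevalE mulr_sumr; apply: eq_big_seq => m /ef em.
rewrite mulrCA; congr (_ * _).
under eq_bigr do rewrite exprMn.
rewrite big_split /=; congr (_ * _).
rewrite (partition_big (fun v : 'I_#|pvar n k| => (enum_val v).1) xpredT) //=.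
apply: eq_bigr => i _; rewrite -em expr_sum.
by apply: eq_bigr => v /eqP ->.
Qed.

(** The character by which the torus acts on the coordinate indexed by v, up to the change of
    basis. *)
Definition weight g (v : 'I_#|pvar n k|) : C :=
  \prod_(j in (enum_val v).2) sval g j j.

(** The factors c from [plucker_act] depend on i alone, so multihomogeneity pulls them out as one
    nonzero scalar. *)
Lemma peval_act_neq0 e f W g : multihomog e f ->
  (peval f (act W g) != 0) =
  (meval (fun v => weight g v *
     plucker (sval W (enum_val v).1) (enum_val v).2) f != 0).
Proof.
move=> ef; have /(_ _)/cid2-/all_sig2[c c0 cE] i := plucker_act W g i.
rewrite /peval; under eq_fun do rewrite cE.
rewrite (multihomog_meval _ _ ef) mulf_eq0 negb_or.
have -> // : \prod_i c i ^+ e i != 0.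
by apply/prodf_neq0 => i _; rewrite expf_neq0.
Qed.

(** This is the substitution of [s v] times the variable v for that variable, written on monomials
    to keep control of the support. *)
Definition scale_mpoly (s : 'I_#|pvar n k| -> C) f : mpoly #|pvar n k| C :=
  \sum_(m <- msupp f) (mcoeff m f * \prod_v s v ^+ m v) *: mpolyX C m.

Lemma meval_scale_mpoly s y f :
  meval y (scale_mpoly s f) = meval (fun v => s v * y v) f.
Proof.
rewrite [RHS]mevalE raddf_sum /=; apply: eq_bigr => m _.
rewrite mevalZ mevalX -mulrA -big_split /=; congr (_ * _).
by apply: eq_bigr => v _; rewrite exprMn.
Qed.

Lemma multihomog_scale_mpoly e s f :
  multihomog e f -> multihomog e (scale_mpoly s f).
Proof.
move=> ef m ms; apply: ef; apply: contraLR ms => mf.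
rewrite -mcoeff_eq0 raddf_sum big1_seq //= => m' m'f.
rewrite mcoeffZ mcoeffX; case: eqVneq => [m'm|]; last by rewrite mulr0.
by rewrite -m'm m'f in mf.
Qed.

Lemma multihomogM e1 e2 f1 f2 : multihomog e1 f1 -> multihomog e2 f2 ->
  multihomog (fun i : 'I_k => (e1 i + e2 i)%N) (f1 * f2).
Proof.
move=> h1 h2 m /msuppM_le/allpairsP[[m1 m2] /= [/h1 m1e /h2 m2e ->]] i.
rewrite -m1e -m2e -big_split /=; apply: eq_bigr => v _.
by rewrite mnmDE.
Qed.

Lemma multihomog1 : multihomog (fun _ => 0%N) (1 : mpoly #|pvar n k| C).
Proof.
move=> m; rewrite msupp1 inE => /eqP -> i.
by rewrite big1 // => v _; rewrite mnm0E.
Qed.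

(** * The Zariski topology and torus orbits *)

Lemma open_peval_neq0 e f :
  multihomog e f -> open [set W : flag | peval f W != 0].
Proof.
move=> ef; exists [set [set W : flag | peval f W != 0]];
  last by rewrite bigcup_set1.
move=> _ ->; exists [fset [set W : flag | peval f W != 0]]%fset => //.
  by move=> A /fset1P ->; rewrite inE; exists f => //; exists e.
rewrite predeqE => W; split => [/(_ [set W : flag | peval f W != 0])|fW A /=].
  by apply; exact/fset1P.
by move=> /fset1P ->.
Qed.

(** The subbase is a base: a finite intersection of nonvanishing loci is the nonvanishing locus of
    the product, which is again multihomogeneous. *)
Lemma open_flag_basis (U : set flag) W : open U -> U W ->
  exists e f, [/\ multihomog e f, peval f W != 0 &
    forall W', peval f W' != 0 -> U W'].
Proof.
move=> [D' sD' <-] [A DA AW].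
have [F sF FA] := sD' _ DA.
have FW : forall S, S \in F -> S W by rewrite -FA in AW.
suff [e [f [ef fW fF]]] : exists e f, [/\ multihomog e f, peval f W != 0 &
    forall W', peval f W' != 0 -> forall S, S \in enum_fset F -> S W'].
  exists e, f; split => // W' /fF W'F; exists A => //; rewrite -FA.
  by change (forall S, S \in F -> S W') => S; exact: W'F.
have : forall S, S \in enum_fset F -> S W /\ exists e f,
    multihomog e f /\ S = [set W : flag | peval f W != 0].
  move=> S SF; split; first exact: FW.
  by have := sF _ SF; rewrite inE => -[f [e ef] <-]; exists e, f.
elim: (enum_fset F) => [_|S s IHs Ss].
  (* The empty intersection is the nonvanishing locus of 1. *)
  exists (fun _ => 0%N), 1; split => //; first exact: multihomog1.
  by rewrite /peval rmorph1 oner_eq0.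
have [S' S's|e [f [ef fW fs]]] := IHs; first by apply: Ss; rewrite inE S's orbT.
have [SW [e' [f' [ef' SE]]]] := Ss S (mem_head _ _).
exists (fun i => (e' i + e i)%N), (f' * f); split.
  exact: multihomogM ef' ef.
  by rewrite /peval mevalM mulf_neq0 //; move: SW; rewrite SE.
move=> W'; rewrite /peval mevalM mulf_eq0 negb_or => /andP[f'W' fW'] S'.
by rewrite inE => /predU1P[->|]; [rewrite SE | exact: fs].
Qed.

(** Translation by g pulls a basic open set back to the one given by the polynomial with variables
    rescaled by their weights. *)
Lemma continuous_act g : continuous (fun W : flag => act W g).
Proof.
apply/continuousP => U oU.
rewrite openE => W /= UW.
have [e [f [ef fW fU]]] := open_flag_basis oU UW.
rewrite /interior nbhsE.
exists [set W : flag | peval (scale_mpoly (weight g) f) W != 0]; last first.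
  move=> W' /=; rewrite /peval meval_scale_mpoly => fW'; apply: fU.
  by rewrite (peval_act_neq0 _ _ ef).
split; first exact: open_peval_neq0 (multihomog_scale_mpoly ef).
by rewrite /= /peval meval_scale_mpoly -(peval_act_neq0 _ _ ef).
Qed.

(** Take a basic neighborhood of [act W g] inside U, given by f. Along the curve l of diagonal
    matrices, f becomes, up to a nonzero scalar, a polynomial q in one variable, with no root at
    t0. *)
Lemma open_line (U : set flag) W g (l : 'I_n -> {poly C}) t0 :
  open U -> U (act W g) -> (forall i, sval g i i = (l i).[t0]) ->
  exists2 q : {poly C}, q != 0 &
    forall t h, (forall i, sval h i i = (l i).[t]) -> q.[t] != 0 -> U (act W h).
Proof.
move=> oU Ug gl.
have [e [f [ef fW fU]]] := open_flag_basis oU Ug.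
pose q := mmap (@polyC C) (fun v : 'I_#|pvar n k| =>
  (\prod_(j in (enum_val v).2) l j) *
  (plucker (sval W (enum_val v).1) (enum_val v).2)%:P) f.
have qE t h : (forall i, sval h i i = (l i).[t]) ->
    q.[t] = meval (fun v => weight h v *
      plucker (sval W (enum_val v).1) (enum_val v).2) f.
  move=> hl; rewrite /q /mmap mevalE horner_sum; apply: eq_bigr => m _.
  rewrite hornerM hornerC; congr (_ * _).
  rewrite /mmap1 horner_prod; apply: eq_bigr => v _.
  rewrite horner_exp hornerM hornerC; congr ((_ * _) ^+ _).
  by rewrite horner_prod; apply: eq_bigr => j _; rewrite hl.
exists q => [|t h hl].
  apply: contraTneq fW => q0.
  by rewrite (peval_act_neq0 _ _ ef) -(qE _ _ gl) q0 horner0 eqxx.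
by rewrite (qE _ _ hl) -(peval_act_neq0 _ _ ef); exact: fU.
Qed.

(* A line in the space of diagonal matrices joins g1 and g2, and each of the
   open conditions excludes only finitely many of its points. *)
Lemma orbit_irreducible (U1 U2 : set flag) W g1 g2 : open U1 -> open U2 ->
  U1 (act W g1) -> U2 (act W g2) -> exists h, U1 (act W h) /\ U2 (act W h).
Proof.
move=> o1 o2 Ug1 Ug2.
pose l i : {poly C} := (sval g1 i i)%:P + (sval g2 i i - sval g1 i i) *: 'X.
have l0 i : sval g1 i i = (l i).[0] by rewrite !hornerE.
have l1 i : sval g2 i i = (l i).[1].
  by rewrite hornerD hornerC hornerZ hornerX mulr1 addrC subrK.
have [q1 q10 q1P] := open_line o1 Ug1 l0.
have [q2 q20 q2P] := open_line o2 Ug2 l1.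
(* The roots of this product are the parameters where the line leaves the torus; no factor is zero,
   since its value at 0 is a diagonal entry of g1. *)
have ll : \prod_i l i != 0.
  apply/prodf_neq0 => i _; apply/eqP => li0.
  by have := torus_neq0 g1 i; rewrite l0 li0 horner0 eqxx.
(* A nonroot exists because an algebraically closed field is infinite. *)
have /closed_nonrootP[t] : q1 * q2 * \prod_i l i != 0 by rewrite !mulf_neq0.
rewrite rootE !hornerM !mulf_eq0 !negb_or horner_prod => /andP[/andP[t1 t2]].
move=> /prodf_neq0 lt0; have [h hl] := diag_torus (fun i => lt0 i isT).
by exists h; split; [exact: q1P hl t1 | exact: q2P hl t2].
Qed.

(** * The quotient map and the point V_M(y) *)

Section Quotient.
Variables (M : plurimatroid n d) (Q : geometric_quotient R M).

Lemma thin_cell_act W g : thin_cell M W -> thin_cell M (act W g).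
Proof. by move=> MW i I dI; rewrite plucker_act_neq0; exact: MW. Qed.

Lemma gq_pi_act (x : thin_cell M) g :
  exists2 x' : thin_cell M, set_val x' = act (set_val x) g &
    gq_pi Q x' = gq_pi Q x.
Proof.
have MW : act (set_val x) g \in thin_cell M.
  by apply/mem_set/thin_cell_act; exact: set_valP.
exists (exist (fun W => W \in thin_cell M) _ MW) => //.
by apply/esym/gq_fiber; exists g.
Qed.

(** If U is the trace of an open V on the cell, its saturation is the union of the preimages of V
    under all translations, each of them open. *)
Lemma open_gq_pi (U : set (thin_cell M)) : open U -> open (gq_pi Q @` U).
Proof.
move=> [V oV VU]; apply/gq_open.
have -> : gq_pi Q @^-1` (gq_pi Q @` U) =
    \bigcup_g ((fun x : thin_cell M => act (set_val x) g) @^-1` V).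
  apply/seteqP; split=> [x [y Uy /esym/gq_fiber[g yE]]|x [g _ /= Vx]].
    by exists g => //=; rewrite -yE; move: Uy; rewrite -VU.
  have [y yE <-] := gq_pi_act x g.
  by exists y => //; rewrite -VU /= yE.
apply: bigcup_open => g _.
have /continuousP/(_ _ oV) := @continuous_act g.
by have /continuousP := @incl_continuous R n k d M; apply.
Qed.

Lemma irreducible_gq_pi_preimage (Y : set Q) :
  irreducible_set Y -> irreducible_set (gq_pi Q @^-1` Y).
Proof.
move=> /irreducible_setP[[q Yq] irrY]; apply/irreducible_setP; split.
  by have [x xq] := gq_surj q; exists x; rewrite /= xq.
move=> U V oU oV [x [Yx Ux]] [y [Yy Vy]].
have [||z [Yz [[u Uu uz] [v Vv vz]]]] :=
    irrY _ _ (open_gq_pi oU) (open_gq_pi oV).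
- by exists (gq_pi Q x); split => //; exists x.
- by exists (gq_pi Q y); split => //; exists y.
(* Here g1 fixes u; it serves to present u, like v, as a translate of u. *)
have /gq_fiber[g1 uE] : gq_pi Q u = gq_pi Q u by [].
have /gq_fiber[g2 vE]  : gq_pi Q u = gq_pi Q v by rewrite uz.
case: oU oV => [U' oU' UE] [V' oV' VE].
(* The orbit argument takes place in the flag variety, with open sets U' and V' that cut out U and
   V; [gq_pi_act] brings the resulting point back to the cell. *)
have [||h [U'h V'h]] :=
    orbit_irreducible (W := set_val u) (g1 := g1) (g2 := g2) oU' oV'.
- by rewrite -uE; move: Uu; rewrite -UE.
- by rewrite -vE; move: Vv; rewrite -VE.
have [w wE wu] := gq_pi_act u h.
exists w; split; first by rewrite /= wu uz.
by split; [rewrite -UE | rewrite -VE]; rewrite /= wE.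
Qed.

Lemma is_spoint_gq_pi_preimage (y : spoint Q) :
  is_spoint (gq_pi Q @^-1` sval y).
Proof.
apply/asboolP; split; last exact/irreducible_gq_pi_preimage/irreducible_spoint.
apply: preimage_closed; last exact: closed_spoint.
by move=> x _; exact: gq_pi_continuous.
Qed.

Definition gq_preimage (y : spoint Q) : spoint (thin_cell M) :=
  exist (fun A => is_spoint A) _ (is_spoint_gq_pi_preimage y).

Lemma isV_spmap (y : spoint Q) :
  isV y (spmap (@incl_continuous R n k d M) (gq_preimage y)).
Proof.
set eta := spmap _ _; split.
  (* Invariance passes to the closure: a neighborhood of [act W g] pulls back to one of W, which
     meets the image of the preimage; the point found there is translated by g. *)
  move=> W g /= cW N nN; have [_ [[x Yx <-] Nx]] := cW _ (continuous_act nN).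
  have [x' x'E x'x] := gq_pi_act x g.
  exists (act (set_val x) g); split => //.
  by exists x' => //; rewrite /= x'x.
apply/seteqP; split.
  (* The generic point of the preimage is itself one of the points over the closure of y. *)
  apply: closureS => _ ->; exists (gq_preimage y) => //.
  rewrite closure_spoint1 /=.
  rewrite [X in _ `<=` X](closure_id _).1; last exact: closed_spoint.
  by apply: closureS => _ [x Yx <-].
(* Conversely, the closure of eta is closed, so it suffices to treat the image of a single p; its
   closed points all lie over [sval y]. *)
rewrite [X in X `<=` _]closureE; apply: smallest_sub.
  exact: closed_closure.
move=> _ [p pY <-]; move: pY; rewrite /= !closure_spoint1 /= => pY.
apply: closureS; apply: image_subset => x px.
by apply: pY; apply: subset_closure; exists x.
Qed.

End Quotient.
End Flags.

Theorem corollary4p8 (R : realType) (n k : nat) (d : 'I_k -> nat)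
    (k_gt0 : (0 < k)%N)
    (d_gt0 : forall i : 'I_k, (0 < d i)%N)
    (d_incr : forall i j : 'I_k, (i < j)%N -> (d i < d j)%N)
    (d_ltn : forall i : 'I_k, (d i < n)%N)
    (Q : forall M : plurimatroid n d, geometric_quotient R M) :
  (forall (M : plurimatroid n d) (y : spoint (Q M)),
     exists! eta : spoint (flag R n d), isV y eta) /\
  (exists! Phi : {M : plurimatroid n d & spoint (Q M)} -> Hflag R n d,
     forall (M : plurimatroid n d) (y : spoint (Q M)) (eta : spoint (flag R n d)),
       isV y eta -> Phi (existT _ M y) = fundamental_class eta).
Proof.
pose V M (y : spoint (Q M)) :=
  spmap (@incl_continuous R n k d M) (gq_preimage y).
have V_uniq M (y : spoint (Q M)) eta : isV y eta -> V M y = eta.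
  have [_ VE] := isV_spmap y; move=> [_ etaE].
  by apply: closure_spoint1_inj; rewrite VE etaE.
split=> [M y|].
  by exists (V M y); split; [exact: isV_spmap | exact: V_uniq].
(* Uniqueness of eta makes this choice satisfy the condition; existence of eta for every y forces
   the value of any other Phi. *)
exists (fun My => fundamental_class (V (projT1 My) (projT2 My))); split.
  by move=> M y eta /V_uniq <-.
by move=> Phi PhiE; apply/funext => -[M y] /=;
  rewrite (PhiE _ _ _ (isV_spmap y)).
Qed.
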